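(* Let $\varepsilon\in\{+1,-1\}$. A 4-dimensional, (locally) conformally flat, almost $\varepsilon$-Hermitian manifold $M(J,g)$ is almost $\varepsilon$-Kählerian if and only if for any point $p\in M$ there is a canonical coordinate neighborhood $(U,(x^0,x^1,x^2,x^3))$, $p\in U$, on which there exist functions $f^1,f^2,f^3\colon U\to\mathbb R$ and a positive function $h\colon U\to\mathbb R$ such that: (i) the functions $f^1,f^2,f^3,h$ are related by the condition $(f^1)^2-(f^2)^2-(f^3)^2=-\varepsilon h^2$, and the paraquaternionic function $f=f^1i_1+f^2i_2+f^3i_3$ is left-regular or right-regular; (ii) $g=hG$, where $G$ is the standard flat metric of signature $(-,-,+,+)$, i.e. the metric with components $G_{00}=G_{11}=-1$, $G_{22}=G_{33}=1$ and $G_{ij}=0$ otherwise in the coordinates $(x^0,x^1,x^2,x^3)$; (iii) if $f$ is left-regular, then $J$ is given by $$[J^i_j]=\begin{bmatrix} 0 & a & b & c \\ -a & 0 & -c & b \\ b & -c & 0 & -a \\ c & b & a & 0 \end{bmatrix},$$ and if $f$ is right-regular, then $J$ is given by $$[J^i_j]=\begin{bmatrix} 0 & a & b & c \\ -a & 0 & c & -b \\ b & c & 0 & a \\ c & -b & -a & 0 \end{bmatrix},$$ where in both cases $a,b,c$ are the functions given by $a=f^1/h$, $b=f^2/h$, $c=f^3/h$.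
   Context: Indices $i,j$ run from $0$ to $3$; in $[J^i_j]$ the upper index $i$ is the row and the lower index $j$ the column, so $J\partial_j=\sum_i J^i_j\partial_i$, where $\partial_j=\partial/\partial x^j$. Almost $\varepsilon$-Hermitian manifold (dimension 4): a connected 4-dimensional differentiable manifold $M$ with a pseudo-Riemannian metric $g$ of signature $(-,-,+,+)$ and a $(1,1)$-tensor field $J$ such that $J^2=\varepsilon I$ and $g(JX,JY)=-\varepsilon g(X,Y)$ for all vector fields $X,Y$, where $\varepsilon$ is a constant equal to $+1$ or $-1$. Its fundamental form is the 2-form $\Omega(X,Y)=g(X,JY)$. The manifold is called almost $\varepsilon$-Kählerian if $d\Omega=0$. $M(J,g)$ is (locally) conformally flat if for every point there exist an open neighborhood $U$ of it and a positive function $h\colon U\to\mathbb R$ such that $g=hG$ on $U$ for some flat pseudo-Riemannian metric $G$. A canonical coordinate neighborhood of a 4-dimensional conformally flat almost $\varepsilon$-Hermitian manifold is a coordinate neighborhood $(U,(x^0,x^1,x^2,x^3))$ on which $g=hG$ with $h$ a positive function and $G$ the flat metric with components $G_{00}=G_{11}=-1$, $G_{22}=G_{33}=1$, $G_{ij}=0$ otherwise, in these coordinates; the matrix of $J$ then has one of the two forms displayed in (iii) for some functions $a,b,c$ with $a^2-b^2-c^2=-\varepsilon$. Paraquaternions: $\mathbb A$ is the associative 4-dimensional real algebra with basis $1,i_1,i_2,i_3$ and $i_1^2=-1$, $i_2^2=i_3^2=1$, $i_1i_2=-i_2i_1=i_3$, $i_2i_3=-i_3i_2=-i_1$, $i_1i_3=-i_3i_1=-i_2$.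 For a real-differentiable function $f=f^0+\sum_{\alpha=1}^3 f^\alpha i_\alpha$ with values in $\mathbb A$ ($f^0,f^\alpha$ real-valued functions of the coordinates $x^0,x^1,x^2,x^3$) put $$D_Lf=\partial_0f+\sum_{\alpha=1}^3 i_\alpha(\partial_\alpha f),\qquad D_Rf=\partial_0f+\sum_{\alpha=1}^3(\partial_\alpha f)i_\alpha .$$ The function $f$ is left-regular if $D_Lf=0$ and right-regular if $D_Rf=0$. A function on the coordinate neighborhood $U$ is regarded as a function on an open subset of $\mathbb R^4$ via the coordinates. *)

(* Defs.v *)
From HB Require Import structures.
From mathcomp Require Import all_boot all_order all_algebra.
From mathcomp Require Import all_classical all_reals all_analysis.
From mathcomp Require Import ring.
Set Implicit Arguments.
Unset Strict Implicit.
Unset Printing Implicit Defensive.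
Import Order.TTheory GRing.Theory Num.Theory.
Import numFieldNormedType.Exports.
Local Open Scope classical_set_scope.
Local Open Scope ring_scope.

Definition partial (R : realType) (W : normedModType R) (j : 'I_4)
    (f : 'rV[R]_4 -> W) : 'rV[R]_4 -> W :=
  fun x => 'D_(delta_mx ord0 j) f x.

(* C^oo on an open set O: the iterated partial derivatives of all orders
   exist and are continuous on O. *)
Definition smooth_on (R : realType) (O : set 'rV[R]_4) (f : 'rV[R]_4 -> R) : Prop :=
  forall (s : seq 'I_4) (x : 'rV[R]_4), O x ->
    {for x, continuous (foldr (@partial R R) f s)} /\
    forall j : 'I_4, derivable (foldr (@partial R R) f s) x (delta_mx ord0 j).

(* A chart is a homeomorphism cmap from the open set cdom onto an open subset of
   R^4, with inverse cinv; cmap and cinv are total functions whose values outside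
   cdom and cmap @` cdom are irrelevant. *)
Record chart (R : realType) (M : topologicalType) := Chart {
  cdom : set M ;
  cmap : M -> 'rV[R]_4 ;
  cinv : 'rV[R]_4 -> M ;
  cdom_open : open cdom ;
  cimg_open : open (cmap @` cdom) ;
  cmapK : forall p, cdom p -> cinv (cmap p) = p ;
  cmap_continuous : forall p, cdom p -> {for p, continuous cmap} ;
  cinv_continuous : forall p, cdom p -> {for cmap p, continuous cinv} }.

Definition cimage (R : realType) (M : topologicalType) (phi : chart R M)
    (U : set M) : set 'rV[R]_4 :=
  cmap phi @` (cdom phi `&` U).

Definition transition (R : realType) (M : topologicalType) (phi psi : chart R M)
    (i : 'I_4) : 'rV[R]_4 -> R :=
  fun x => cmap psi (cinv phi x) ord0 i.

Definition compatible (R : realType) (M : topologicalType) (phi psi : chart R M) : Prop :=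
  (forall i, smooth_on (cimage phi (cdom psi)) (transition phi psi i)) /\
  (forall i, smooth_on (cimage psi (cdom phi)) (transition psi phi i)).

(* M with the maximal smooth atlas A; the members of A are the coordinate
   neighborhoods of M. *)
Record connected_manifold (R : realType) (M : topologicalType)
    (A : set (chart R M)) : Prop := ConnectedManifold {
  manifold_hausdorff : hausdorff_space M ;
  manifold_second_countable : @second_countable M ;
  manifold_connected : connected [set: M] ;
  atlas_cover : forall p : M, exists2 phi, A phi & cdom phi p ;
  atlas_compatible : forall phi psi, A phi -> A psi -> compatible phi psi ;
  atlas_maximal : forall phi, (forall psi, A psi -> compatible phi psi) -> A phi }.

Definition jacobi (R : realType) (M : topologicalType) (phi psi : chart R M)
    (p : M) : 'M[R]_4 :=
  \matrix_(i, j) partial j (transition phi psi i) (cmap phi p).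

(* A tensor field of rank 2 is given classically, by its matrix of components
   T phi p in each chart phi at each point p of cdom phi (values elsewhere are
   irrelevant), subject to the transformation law of its type. *)
Definition components (R : realType) (M : topologicalType) :=
  chart R M -> M -> 'M[R]_4.

Definition smooth_components (R : realType) (M : topologicalType)
    (A : set (chart R M)) (U : set M) (T : components R M) : Prop :=
  forall phi, A phi -> forall i j : 'I_4,
    smooth_on (cimage phi U) (fun x => T phi (cinv phi x) i j).

(* T_ij = (dy^k/dx^i) (dy^l/dx^j) T'_kl *)
Definition tensor02 (R : realType) (M : topologicalType)
    (A : set (chart R M)) (U : set M) (T : components R M) : Prop :=
  smooth_components A U T /\
  forall phi psi p, A phi -> A psi -> cdom phi p -> cdom psi p -> U p ->
    T phi p = (jacobi phi psi p)^T *m T psi p *m jacobi phi psi p.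

(* (dy^i/dx^k) T^k_j = T'^i_l (dy^l/dx^j) *)
Definition tensor11 (R : realType) (M : topologicalType)
    (A : set (chart R M)) (U : set M) (T : components R M) : Prop :=
  smooth_components A U T /\
  forall phi psi p, A phi -> A psi -> cdom phi p -> cdom psi p -> U p ->
    jacobi phi psi p *m T phi p = T psi p *m jacobi phi psi p.

Definition pseudo_metric (R : realType) (M : topologicalType)
    (A : set (chart R M)) (U : set M) (g : components R M) : Prop :=
  tensor02 A U g /\
  forall phi p, A phi -> cdom phi p -> U p ->
    (g phi p)^T = g phi p /\ g phi p \in unitmx.

Definition mx_of_rows (R : realType) (s : seq (seq R)) : 'M[R]_4 :=
  \matrix_(i, j) nth 0 (nth [::] s i) j.

Definition stdG (R : realType) : 'M[R]_4 := mx_of_rows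
  [:: [:: -1;  0; 0; 0];
      [::  0; -1; 0; 0];
      [::  0;  0; 1; 0];
      [::  0;  0; 0; 1] ].

(* Existence of an orthonormal basis (the columns of P) of type (-,-,+,+) in
   every tangent space. *)
Definition neutral_signature (R : realType) (M : topologicalType)
    (A : set (chart R M)) (g : components R M) : Prop :=
  forall phi p, A phi -> cdom phi p ->
    exists2 P : 'M[R]_4, P \in unitmx & P^T *m g phi p *m P = stdG R.

(* Local isometry with a pseudo-Euclidean space: near every point of U there are
   coordinates in which the components of G are constant. *)
Definition flat (R : realType) (M : topologicalType)
    (A : set (chart R M)) (U : set M) (G : components R M) : Prop :=
  forall p, U p -> exists phi,
    [/\ A phi, cdom phi p, cdom phi `<=` U
      & exists C : 'M[R]_4, forall q, cdom phi q -> G phi q = C].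

Definition conformally_flat (R : realType) (M : topologicalType)
    (A : set (chart R M)) (g : components R M) : Prop :=
  forall p : M, exists (U : set M) (h : M -> R) (G : components R M),
    [/\ open U /\ U p,
        forall q, U q -> 0 < h q,
        pseudo_metric A U G /\ flat A U G
      & forall phi q, A phi -> cdom phi q -> U q -> g phi q = h q *: G phi q].

(* Tangent vectors at p are represented by the column of their components in a
   chart; delta_mx j ord0 represents the j-th coordinate vector field. *)
Definition bilin (R : realType) (B : 'M[R]_4) (X Y : 'cV[R]_4) : R :=
  (X^T *m B *m Y) ord0 ord0.

Record almost_hermitian (R : realType) (eps : R) (M : topologicalType)
    (A : set (chart R M)) (g J : components R M) : Prop := AlmostHermitian {
  hermitian_metric : pseudo_metric A [set: M] g ;
  hermitian_signature : neutral_signature A g ;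
  hermitian_tensor : tensor11 A [set: M] J ;
  hermitian_square : forall phi p, A phi -> cdom phi p ->
    J phi p *m J phi p = eps%:M ;
  hermitian_compatible : forall phi p, A phi -> cdom phi p ->
    forall X Y : 'cV[R]_4,
      bilin (g phi p) (J phi p *m X) (J phi p *m Y) = - eps * bilin (g phi p) X Y }.

Definition Omega (R : realType) (M : topologicalType) (g J : components R M)
    (phi : chart R M) (p : M) (X Y : 'cV[R]_4) : R :=
  bilin (g phi p) X (J phi p *m Y).

Definition Omega_comp (R : realType) (M : topologicalType) (g J : components R M)
    (phi : chart R M) (i j : 'I_4) (x : 'rV[R]_4) : R :=
  Omega g J phi (cinv phi x) (delta_mx i ord0) (delta_mx j ord0).

(* d Omega = 0, that is,
   (d Omega)_ijk = d_i Omega_jk + d_j Omega_ki + d_k Omega_ij = 0 in every chart. *)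
Definition almost_kahler (R : realType) (M : topologicalType)
    (A : set (chart R M)) (g J : components R M) : Prop :=
  forall phi x, A phi -> cimage phi setT x -> forall i j k : 'I_4,
    partial i (Omega_comp g J phi j k) x + partial j (Omega_comp g J phi k i) x
      + partial k (Omega_comp g J phi i j) x = 0.

(* Paraquaternions x_0 + x_1 i_1 + x_2 i_2 + x_3 i_3 as coordinate rows. *)
Definition pquat (R : realType) := 'rV[R]_4.

Definition pqi (R : realType) (j : 'I_4) : pquat R := delta_mx ord0 j.

Definition pqmul (R : realType) (u v : pquat R) : pquat R :=
  let x k := u ord0 (inord k) in
  let y k := v ord0 (inord k) in
  \row_k nth 0
    [:: x 0%N * y 0%N - x 1%N * y 1%N + x 2%N * y 2%N + x 3%N * y 3%N;
        x 0%N * y 1%N + x 1%N * y 0%N - x 2%N * y 3%N + x 3%N * y 2%N;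
        x 0%N * y 2%N + x 2%N * y 0%N - x 1%N * y 3%N + x 3%N * y 1%N;
        x 0%N * y 3%N + x 3%N * y 0%N + x 1%N * y 2%N - x 2%N * y 1%N ] k.

Lemma pqmul1 (R : realType) (u : pquat R) :
  pqmul (pqi R ord0) u = u /\ pqmul u (pqi R ord0) = u.
Proof.
split; apply/rowP => k; rewrite /pqi !mxE -!val_eqE /= !inordK //;
  have -> : k = inord k by rewrite inord_val.
all: by rewrite inordK //; case: k => [[|[|[|[|//]]]]] kP /=; ring.
Qed.

Lemma pqmul_table (R : realType) :
  let e k : pquat R := pqi R (inord k) in
  [/\ pqmul (e 1%N) (e 1%N) = - e 0%N, pqmul (e 2%N) (e 2%N) = e 0%N
    & pqmul (e 3%N) (e 3%N) = e 0%N] /\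
  [/\ pqmul (e 1%N) (e 2%N) = e 3%N, pqmul (e 2%N) (e 1%N) = - e 3%N,
      pqmul (e 2%N) (e 3%N) = - e 1%N & pqmul (e 3%N) (e 2%N) = e 1%N] /\
  (pqmul (e 1%N) (e 3%N) = - e 2%N /\ pqmul (e 3%N) (e 1%N) = e 2%N).
Proof.
by move=> e; (do !split); apply/rowP => k; rewrite /e /pqi !mxE -!val_eqE /= !inordK //;
  case: k => [[|[|[|[|//]]]]] kP /=; ring.
Qed.

Lemma pqmulA (R : realType) : associative (@pqmul R).
Proof.
move=> u v w; apply/rowP => k; rewrite !mxE !inordK //=.
by case: k => [[|[|[|[|//]]]]] kP /=; ring.
Qed.

Lemma pqmul_bilinear (R : realType) (a : R) (u v w : pquat R) :
  pqmul (a *: u + v) w = a *: pqmul u w + pqmul v w /\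
  pqmul w (a *: u + v) = a *: pqmul w u + pqmul w v.
Proof.
by split; apply/rowP => k; rewrite !mxE;
   case: k => [[|[|[|[|//]]]]] kP /=; ring.
Qed.

Definition DL (R : realType) (f : 'rV[R]_4 -> pquat R) (x : 'rV[R]_4) : pquat R :=
  partial ord0 f x + \sum_(j < 4 | j != ord0) pqmul (pqi R j) (partial j f x).

Definition DR (R : realType) (f : 'rV[R]_4 -> pquat R) (x : 'rV[R]_4) : pquat R :=
  partial ord0 f x + \sum_(j < 4 | j != ord0) pqmul (partial j f x) (pqi R j).

Definition left_regular (R : realType) (V : set 'rV[R]_4)
    (f : 'rV[R]_4 -> pquat R) : Prop :=
  forall x, V x -> differentiable f x /\ DL f x = 0.

Definition right_regular (R : realType) (V : set 'rV[R]_4)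
    (f : 'rV[R]_4 -> pquat R) : Prop :=
  forall x, V x -> differentiable f x /\ DR f x = 0.

Definition pqfun (R : realType) (M : topologicalType) (f1 f2 f3 : M -> R)
    (p : M) : pquat R :=
  f1 p *: pqi R (inord 1%N) + f2 p *: pqi R (inord 2%N) + f3 p *: pqi R (inord 3%N).

Definition leftJ (R : realType) (a b c : R) : 'M[R]_4 := mx_of_rows
  [:: [::  0;  a;  b;  c];
      [:: -a;  0; -c;  b];
      [::  b; -c;  0; -a];
      [::  c;  b;  a;  0] ].

Definition rightJ (R : realType) (a b c : R) : 'M[R]_4 := mx_of_rows
  [:: [::  0;  a;  b;  c];
      [:: -a;  0;  c; -b];
      [::  b;  c;  0;  a];
      [::  c; -b; -a;  0] ].

(* Main.v *)
(* Put Omega = g *m J, an antisymmetric matrix. In coordinates where g = h stdG, the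
   equation J^2 = eps forces J, at each point, into exactly one of the two chiral forms
   [leftJ] and [rightJ]; the sign of a polynomial in the entries of J tells which one, so
   the form is locally constant. The entries of Omega are then the f^a up to sign, and the
   four independent equations of d Omega = 0 are the four components of D_L f = 0,
   respectively D_R f = 0. Coordinates with g = h stdG come from flat ones by a linear
   change putting the constant metric in normal form. Conversely, d Omega = 0 passes from
   these charts to all others by the chain rule, the symmetry of second derivatives and
   the antisymmetry of Omega. *)

Require Import Defs.
From HB Require Import structures.
From mathcomp Require Import all_boot all_order all_algebra.
From mathcomp Require Import all_classical all_reals all_analysis.
From mathcomp Require Import ring lra.
Set Implicit Arguments.
Unset Strict Implicit.
Unset Printing Implicit Defensive.
Import Order.TTheory GRing.Theory Num.Theory.
Import numFieldNormedType.Exports.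
Local Open Scope classical_set_scope.
Local Open Scope ring_scope.

(** * Differential calculus in several variables *)

Lemma is_derive_line (R : realType) (V : normedModType R) (f : V -> R) (x v : V) (t : R) :
  derivable f (x + t *: v) v ->
  is_derive t 1 (fun s : R => f (x + s *: v)) ('D_v f (x + t *: v)).
Proof.
pose F (s : R) := f (x + s *: v).
have E : (fun h : R => h^-1 *: ((F \o shift t) (h *: (1 : R)) - F t))
   = (fun h : R => h^-1 *: ((f \o shift (x + t *: v)) (h *: v) - f (x + t *: v))).
  apply/funext => h /=; rewrite /F; congr (_ *: (f _ - _)).
  by rewrite [h *: 1]mulr1 scalerDl addrCA.
move=> df; split; first by rewrite /derivable E.
by rewrite /derive E.
Qed.

(** The one-variable mean value theorem for the restriction of [f] to a line. Bounding [|t|] by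
    [|a|] covers both signs of [a], treated on [[0, a]] and [[a, 0]]. *)
Lemma mvt_line (R : realType) (V : normedModType R) (f : V -> R) (x v : V) (a : R) :
  (forall t : R, `|t| <= `|a| -> derivable f (x + t *: v) v) ->
  exists2 t : R, `|t| <= `|a| & f (x + a *: v) - f x = a * 'D_v f (x + t *: v).
Proof.
move=> df.
pose g (s : R) := f (x + s *: v).
have dg (t : R) : `|t| <= `|a| -> is_derive t 1 g ('D_v f (x + t *: v)).
  by move=> /df; exact: is_derive_line.
have g0 : g 0 = f x by rewrite /g scale0r addr0.
have [a0|a0] := leP 0 a.
  have le (t : R) : t \in `[0, a] -> `|t| <= `|a|.
    by rewrite in_itv /= => /andP[t0 ta]; rewrite !ger0_norm.
  have [||c cI E] := @MVT_segment R g (fun t => 'D_v f (x + t *: v)) 0 a a0.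
  - by move=> t tI; apply: dg; apply: le; rewrite in_itv /= !ltW ?(itvP tI).
  - apply: derivable_within_continuous => t tI.
    exact: (@ex_derive _ _ _ _ _ _ _ (dg t (le t tI))).
  exists c; first exact: le.
  by rewrite -g0 -/(g a) E subr0 mulrC.
have le (t : R) : t \in `[a, 0] -> `|t| <= `|a|.
  by rewrite in_itv /= => /andP[t0 ta]; rewrite !ler0_norm ?lerN2 // ltW.
have [||c cI E] := @MVT_segment R g (fun t => 'D_v f (x + t *: v)) a 0 (ltW a0).
- by move=> t tI; apply: dg; apply: le; rewrite in_itv /= !ltW ?(itvP tI).
- apply: derivable_within_continuous => t tI.
  exact: (@ex_derive _ _ _ _ _ _ _ (dg t (le t tI))).
exists c; first exact: le.
by rewrite -g0 -/(g a) -opprB E sub0r mulrN opprK mulrC.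
Qed.

Lemma coord_le_norm (R : realType) n (v : 'rV[R]_n) j : `|v ord0 j| <= `|v|.
Proof.
rewrite [leRHS]/Num.Def.normr /= mx_normrE.
exact: (le_bigmax _ (fun ij : 'I_1 * 'I_n => `|v ij.1 ij.2|) (ord0, j)).
Qed.

Lemma norm_le_coord (R : realType) n (v : 'rV[R]_n) (c : R) :
  0 <= c -> (forall j, `|v ord0 j| <= c) -> `|v| <= c.
Proof.
move=> c0 vc; rewrite [leLHS]/Num.Def.normr /= mx_normrE bigmax_le //= => -[i j] _.
by rewrite ord1.
Qed.

Lemma dist_le_half (R : realFieldType) (p q r q' e : R) :
  `|p - q| <= e / 2 -> `|r - q'| <= e / 2 -> q = q' -> `|p - r| <= e.
Proof.
move=> pq rq E; rewrite -{}E distrC in rq.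
by rewrite -(subrKA q) (splitr e) (le_trans (ler_normD _ _)) // lerD.
Qed.

Lemma schwarz (R : realType) (V : normedModType R) (f : V -> R) (x u v : V) :
  (\forall y \near x, [/\ derivable f y u, derivable f y v,
     derivable ('D_u f) y v & derivable ('D_v f) y u]) ->
  {for x, continuous ('D_v ('D_u f))} -> {for x, continuous ('D_u ('D_v f))} ->
  'D_v ('D_u f) x = 'D_u ('D_v f) x.
Proof.
move=> dnear c1 c2; apply/eqP; rewrite -subr_eq0 -normr_le0.
apply/ler_addgt0Pr => e e0; rewrite add0r.
have e2 : 0 < e / 2 by rewrite divr_gt0.
have /cvgrPdist_le/(_ _ e2) n1 := c1.
have /cvgrPdist_le/(_ _ e2) n2 := c2.
have [d /= d0 dP] := (nbhs_ballP _ _).1 (filterI dnear (filterI n1 n2)).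
have exch (p q r z : R) : p - q - (r - z) = p - r - (q - z) by ring.
(* With this side [s], the parallelogram spanned at [x] by [s *: u] and [s *: v] lies in the ball of
   radius [d]; the summand 1 makes the inclusion strict and the division legitimate even if [u] and
   [v] vanish. *)
pose s := d / (`|u| + `|v| + 1).
have k0 : 0 < `|u| + `|v| + 1 by rewrite ltr_pwDr // addr_ge0.
have s0 : 0 < s by rewrite divr_gt0.
have inb a b : `|a| <= `|s| -> `|b| <= `|s| -> ball x d (x + a *: u + b *: v).
  move=> las lbs; rewrite -ball_normE /ball_ /= -addrA opprD addrA subrr sub0r normrN.
  apply: (le_lt_trans (ler_normD _ _)); rewrite !normrZ.
  have -> : d = s * (`|u| + `|v| + 1) by rewrite /s divfK // gt_eqF.
  rewrite (gtr0_norm s0) in las lbs.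
  apply: (@le_lt_trans _ _ (s * (`|u| + `|v|))); last by rewrite ltr_pM2l // ltrDl.
  by rewrite mulrDr lerD // ler_wpM2r.
have s_0 : `|0 : R| <= `|s| by rewrite normr0.
have s_s : `|s| <= `|s| by [].
have swap a b : x + a *: u + b *: v = x + b *: v + a *: u by rewrite addrAC.
have shiftE (w y z : V) : derivable f (y + w) z ->
    is_derive y z (fun y => f (y + w)) ('D_z f (y + w)).
  have E : (fun h : R => h^-1 *: (((fun y => f (y + w)) \o shift y) (h *: z) - f (y + w)))
     = (fun h : R => h^-1 *: ((f \o shift (y + w)) (h *: z) - f (y + w))).
    by apply/funext => h /=; rewrite addrA.
  by move=> dd; split; rewrite /derivable /derive E.
(* The second difference of [f] along [u'] and [v'] is symmetric in the two
   directions; two mean values turn it into a mixed derivative. *)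
have main (u' v' : V) :
   (forall a b, `|a| <= `|s| -> `|b| <= `|s| ->
      [/\ derivable f (x + a *: u' + b *: v') u' &
          derivable ('D_u' f) (x + a *: u' + b *: v') v']) ->
   exists2 ab : R * R, `|ab.1| <= `|s| /\ `|ab.2| <= `|s| &
    f (x + s *: u' + s *: v') - f (x + s *: u') - (f (x + s *: v') - f x) =
    s * s * 'D_v' ('D_u' f) (x + ab.1 *: u' + ab.2 *: v').
  move=> dd.
  pose F y := f (y + s *: v') - f y.
  have dF a : `|a| <= `|s| -> is_derive (x + a *: u') u' F
     ('D_u' f (x + a *: u' + s *: v') - 'D_u' f (x + a *: u')).
    move=> la; apply: is_deriveB.
      by apply: shiftE; case: (dd _ _ la s_s).
    by apply: derivableP; have [] := dd _ _ la s_0; rewrite scale0r addr0.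
  have [|a la E1] := @mvt_line _ _ F x u' s; first by move=> t /dF dFt; apply: ex_derive.
  have [|b lb E2] := @mvt_line _ _ ('D_u' f) (x + a *: u') v' s.
    by move=> t lt; case: (dd _ _ la lt).
  exists (a, b) => //=; rewrite -/(F (x + s *: u')) -/(F x) E1.
  by rewrite (@derive_val _ _ _ _ _ _ _ (dF a la)) E2 mulrA.
have [|[a b] /= [la lb] E1] := main u v.
  by move=> a b la lb; have [[d1 _ d3 _] _] := dP _ (inb a b la lb); exact: conj d1 d3.
have [|[b' a'] /= [lb' la'] E2] := main v u.
  move=> b' a' lb' la'; have [] := dP _ (inb a' b' la' lb').
  by rewrite (swap a' b') => -[_ d2 _ d4] _; exact: conj d2 d4.
rewrite -(swap s s) in E2.
(* Both sides times [s * s] are the same second difference. The two points may differ, but both are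
   near [x], where each mixed derivative is within [e / 2] of its value at [x]. *)
have E : 'D_v ('D_u f) (x + a *: u + b *: v) = 'D_u ('D_v f) (x + b' *: v + a' *: u).
  apply: (@mulfI _ (s * s)); first by rewrite mulf_neq0 // gt_eqF.
  exact: etrans (esym E1) (etrans (exch _ _ _ _) E2).
have [_ [/= d1 _]] := dP _ (inb a b la lb).
have [_ [_ /= d2]] := dP _ (inb a' b' la' lb').
rewrite (swap a' b') in d2.
exact: dist_le_half d1 d2 E.
Qed.

(** The increment of [f] telescopes along a path parallel to the axes. On each leg the mean value
    theorem yields a partial derivative at a nearby point, which continuity at [x] compares with the
    one at [x]. *)
Lemma c1_differentiable (R : realType) n (f : 'rV[R]_n -> R) (x : 'rV[R]_n) :
  (\forall y \near x, forall j, derivable f y (delta_mx ord0 j)) ->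
  (forall j, {for x, continuous ('D_(delta_mx ord0 j) f)}) ->
  differentiable f x.
Proof.
move=> dnear cD.
pose D j := 'D_(delta_mx ord0 j) f.
pose L (v : 'rV[R]_n) : R := \sum_j v ord0 j * D j x.
have Llin : linear (L : _ -> R).
  move=> k u w; rewrite /L scaler_sumr -big_split; apply: eq_bigr => j _ /=.
  by rewrite !mxE mulrDl -mulrA.
pose LM := GRing.isLinear.Build _ _ _ _ _ Llin.
pose LL : {linear 'rV[R]_n -> R} := HB.pack L LM.
have LLE : (LL : _ -> R) = \sum_j (fun v : 'rV[R]_n => v ord0 j * D j x).
  by apply/funext => v; rewrite fct_sumE.
have cL : continuous LL.
  rewrite LLE => v; apply: differentiable_continuous; apply: differentiable_sum => j.
  by apply: differentiableM; [exact: differentiable_coord|exact: differentiable_cst].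
have key : f \o shift x = cst (f x) + (LL : 'rV[R]_n -> R) +o_ (0 : 'rV[R]_n) id.
  apply/eqaddoP => _/posnumP[e]; have e0 : 0 < e%:num by [].
  move: e%:num e0 => {}e e0.
  (* Each of the [n] legs of the path gets an error of this size relative to [|h|]; the denominator
     [n.+1] stays nonzero for [n = 0]. *)
  have e1 : 0 < e / n.+1%:R by rewrite divr_gt0.
  have n1 : \forall y \near x, forall j, `|D j x - D j y| <= e / n.+1%:R.
    pose close j y := `|D j x - D j y| <= e / n.+1%:R.
    apply: (@filter_forall _ _ close (nbhs x) _) => j.
    by have /cvgrPdist_le/(_ _ e1) := cD j.
  have [d /= d0 dP] := (nbhs_ballP _ _).1 (filterI dnear n1).
  near=> h.
  have hd : `|h| < d by near: h; exact: (@nbhs0_lt R 'rV[R]_n).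
  (* The segment from [x] to [x + h] is replaced by a path parallel to the axes. *)
  pose hk k : 'rV[R]_n := \row_j (if (j < k)%N then h ord0 j else 0).
  have hkS (k : 'I_n) : hk k.+1 = hk k + h ord0 k *: delta_mx ord0 k.
    apply/rowP => j; rewrite !mxE /= ltnS leq_eqVlt.
    case: (ltngtP j k) => [jk|kj|/val_inj ->] /=.
    - by rewrite -val_eqE /= ltn_eqF // mulr0 addr0.
    - by rewrite -val_eqE /= gtn_eqF // mulr0 addr0.
    - by rewrite eqxx mulr1 add0r.
  have inb (k : 'I_n) t : `|t| <= `|h ord0 k| ->
      ball x d (x + hk k + t *: delta_mx ord0 k).
    move=> lt; rewrite -ball_normE /ball_ /= -addrA opprD addrA subrr sub0r normrN.
    apply: le_lt_trans hd; apply: norm_le_coord => // j; rewrite !mxE /=.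
    have [->|jk] := eqVneq j k.
      by rewrite ltnn mulr1 add0r (le_trans lt) // coord_le_norm.
    by rewrite mulr0 addr0; case: ifP => _; rewrite ?normr0 ?coord_le_norm.
  have step (k : 'I_n) : `|f (x + hk k.+1) - f (x + hk k) - h ord0 k * D k x|
      <= `|h| * (e / n.+1%:R).
    rewrite hkS addrA.
    have [|t lt ->] := @mvt_line _ _ f (x + hk k) (delta_mx ord0 k) (h ord0 k).
      by move=> t /inb/dP[].
    have [_ /= /(_ k) dt] := dP _ (inb _ _ lt).
    by rewrite -mulrBr normrM distrC ler_pM // coord_le_norm.
  have hn : hk n = h by apply/rowP => j; rewrite !mxE ltn_ord.
  have h0 : hk 0%N = 0 by apply/rowP => j; rewrite !mxE.
  have E : f (h + x) - (f x + L h) =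
     \sum_(k < n) (f (x + hk k.+1) - f (x + hk k) - h ord0 k * D k x).
    rewrite sumrB -(big_mkord xpredT (fun k => f (x + hk k.+1) - f (x + hk k))).
    rewrite telescope_sumr // hn h0 addr0 -/(L h).
    by rewrite [h + x]addrC opprD addrA.
  rewrite -[X in `|X|]/(f (h + x) - (f x + L h)) E.
  apply: (le_trans (ler_norm_sum _ _ _)).
  apply: (le_trans (ler_sum _ (fun k _ => step k))).
  rewrite sumr_const card_ord -mulrnAr -[leRHS]mulrC ler_wpM2l //.
  rewrite -mulr_natr -mulrA ger_pMr // mulrC ler_pdivrMr // mul1r ler_nat //.
apply/diff_locallyP; rewrite (diff_unique cL key); split => //.
Unshelve. all: by end_near. Qed.

(** * Derivatives of finite sums, the chain rule in coordinates, linear maps *)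

Lemma differentiable_fin_sum (R : numFieldType) (V W : normedModType R)
    (I : finType) (f : I -> V -> W) (x : V) :
  (forall i, differentiable (f i) x) -> differentiable (\sum_i f i) x.
Proof.
by elim/big_ind : _ => // ? ? g h ?; apply: differentiableD; [exact: g|exact: h].
Qed.

Lemma derive_fin_sum (R : numFieldType) (V W : normedModType R)
    (I : finType) (f : I -> V -> W) (x v : V) :
  (forall i, derivable (f i) x v) -> 'D_v (\sum_i f i) x = \sum_i 'D_v (f i) x.
Proof.
move=> df; suff : is_derive x v (\sum_i f i) (\sum_i 'D_v (f i) x) by case.
have {}df i : is_derive x v (f i) ('D_v (f i) x) by exact: derivableP.
by elim/big_ind2 : _ => // [|] *; [exact: is_derive_cst|exact: is_deriveD].
Qed.

Lemma differentiable_rV (R : realType) (V : normedModType R) n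
    (F : V -> 'rV[R]_n) (x : V) :
  (forall i, differentiable (fun y => F y ord0 i) x) -> differentiable F x.
Proof.
move=> dF.
have -> : F = \sum_i (fun y => F y ord0 i *: (delta_mx ord0 i : 'rV[R]_n)).
  by apply/funext => y; rewrite fct_sumE {1}[F y]row_sum_delta.
by apply: differentiable_fin_sum => i; exact: differentiableZl.
Qed.

Lemma derive_comp_rV (R : realType) (V : normedModType R) n (f : 'rV[R]_n -> R)
    (F : V -> 'rV[R]_n) (x v : V) :
  differentiable f (F x) -> differentiable F x ->
  'D_v (f \o F) x =
    \sum_l 'D_v (fun y => F y ord0 l) x * 'D_(delta_mx ord0 l) f (F x).
Proof.
move=> df dF.
have L (c : R) w : 'd f (F x) (c *: w) = c * 'd f (F x) w by exact: linearZ.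
rewrite deriveE; last exact: differentiable_comp.
rewrite diff_comp //= [in LHS](row_sum_delta ('d F x v)) raddf_sum.
apply: eq_bigr => l _; apply: etrans (L _ _) _; congr (_ * _).
  by rewrite -deriveE // derive_mx ?mxE //; exact: diff_derivable.
by rewrite deriveE.
Qed.

Lemma differentiable_mulmxr (R : realType) m n (Q : 'M[R]_(m, n)) (x : 'rV[R]_m) :
  differentiable (fun y : 'rV[R]_m => y *m Q) x.
Proof.
apply: differentiable_rV => i.
have -> : (fun y : 'rV[R]_m => (y *m Q) ord0 i) =
    \sum_k (fun y : 'rV[R]_m => y ord0 k * Q k i).
  by apply/funext => y; rewrite fct_sumE mxE.
apply: differentiable_fin_sum => k.
by apply: differentiableM; [exact: differentiable_coord|exact: differentiable_cst].
Qed.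

Lemma derive_mulmxr (R : realType) m n (Q : 'M[R]_(m, n)) (x v : 'rV[R]_m) :
  'D_v (fun y : 'rV[R]_m => y *m Q) x = v *m Q.
Proof.
apply/cvg_lim => //; apply: cvg_near_cst.
near=> h; rewrite /= mulmxDl addrK -scalemxAl scalerA mulVf ?scale1r //.
by near: h; exact: nbhs_dnbhs_neq.
Unshelve. all: by end_near. Qed.

Lemma near_eq_continuous (T U : topologicalType) (f g : T -> U) (x : T) :
  (\near x, f x = g x) -> {for x, continuous f} -> {for x, continuous g}.
Proof.
move=> fg cf; rewrite /prop_for /continuous_at -(nbhs_singleton fg).
by apply: cvg_trans cf; apply: near_eq_cvg; apply: filterS fg => y.
Qed.

(** * Smooth functions on open subsets of R^4 *)

Section Smooth.
Variable R : realType.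
Implicit Types (O : set 'rV[R]_4) (f : 'rV[R]_4 -> R).

Lemma partial_near_eq f f' (x : 'rV[R]_4) j :
  (\near x, f x = f' x) -> partial j f x = partial j f' x.
Proof. exact: near_eq_derive. Qed.

Lemma open_near (T : topologicalType) (O : set T) x (P : T -> Prop) :
  open O -> O x -> (forall y, O y -> P y) -> \near x, P x.
Proof.
by move=> oO Ox OP; apply: filterS OP _; exact: open_nbhs_nbhs.
Qed.

Lemma smooth_on_sub O O' f : O' `<=` O -> smooth_on O f -> smooth_on O' f.
Proof. by move=> OO sf s x /OO; exact: sf. Qed.

Lemma smooth_on_partial O f j : smooth_on O f -> smooth_on O (partial j f).
Proof. by move=> sf s x Ox; rewrite -foldr_rcons; exact: sf. Qed.

Lemma smooth_on_differentiable O f x :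
  open O -> smooth_on O f -> O x -> differentiable f x.
Proof.
move=> oO sf Ox; apply: c1_differentiable => [|j].
  by apply: open_near oO Ox _ => y Oy j; have [_] := sf [::] y Oy; exact.
by have [] := sf [:: j] x Ox.
Qed.

Lemma smooth_on_schwarz O f x i j : open O -> smooth_on O f -> O x ->
  partial i (partial j f) x = partial j (partial i f) x.
Proof.
move=> oO sf Ox; apply: schwarz.
- apply: open_near oO Ox _ => y Oy; have [_ d0] := sf [::] y Oy.
  by have [_ di] := sf [:: i] y Oy; have [_ dj] := sf [:: j] y Oy; split.
- by have [] := sf [:: i; j] x Ox.
- by have [] := sf [:: j; i] x Ox.
Qed.

(** A bootstrap that reduces smoothness to first derivatives: by induction on [s], every iterated
    partial derivative agrees on [O] with a member of [F], hence is continuous and has partial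
    derivatives there. *)
Lemma smooth_on_stable O (F : ('rV[R]_4 -> R) -> Prop) : open O ->
  (forall f x, F f -> O x -> differentiable f x) ->
  (forall f j, F f -> exists2 f', F f' & {in O, partial j f =1 f'}) ->
  forall f, F f -> smooth_on O f.
Proof.
move=> oO dF pF f Ff s x Ox.
have [f' Ff' E] : exists2 f', F f' & {in O, foldr (@partial R R) f s =1 f'}.
  elim: s => [|j s [f' Ff' E]]; first by exists f.
  have [f'' Ff'' E'] := pF f' j Ff'; exists f'' => // y yO.
  rewrite -E' //=; apply: partial_near_eq; move: yO; rewrite inE => Oy.
  by apply: open_near oO Oy _ => z Oz; apply: E; rewrite inE.
have nE : \near x, f' x = foldr (@partial R R) f s x.
  by apply: open_near oO Ox _ => z Oz; rewrite E // inE.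
have df' := dF _ _ Ff' Ox.
split; first by apply: near_eq_continuous nE _; exact: differentiable_continuous.
by move=> j; apply: near_eq_derivable nE _; exact: diff_derivable.
Qed.

Lemma open_mulmxr O (Q : 'M[R]_4) : open O -> open [set x | O (x *m Q)].
Proof.
move=> oO; apply: open_comp => // x _.
exact/differentiable_continuous/differentiable_mulmxr.
Qed.

(** Combinations of this shape form a class stable under partial derivatives. The shape covers both
    composition with a linear map (a single summand) and linear combinations of smooth functions
    ([Q = 1]). *)
Lemma smooth_on_linear O (Q : 'M[R]_4) (I : finType) (c : I -> R)
    (u : I -> 'rV[R]_4 -> R) :
  open O -> (forall i, smooth_on O (u i)) ->
  smooth_on [set x | O (x *m Q)] (fun x => \sum_i c i * u i (x *m Q)).
Proof.
move=> oO su.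
(* The index type is quantified because each derivative enlarges it: the chain rule replaces [J] by
   [J * 'I_4]. *)
pose F f := exists (I : finType) (c : I -> R) (u : I -> 'rV[R]_4 -> R),
  (forall i, smooth_on O (u i)) /\ f = \sum_i (fun x => c i * u i (x *m Q)).
have dF (u' : 'rV[R]_4 -> R) x : smooth_on O u' -> O (x *m Q) ->
    differentiable (fun x => u' (x *m Q)) x.
  move=> su' Ox.
  apply: (@differentiable_comp _ _ _ _ (fun x : 'rV[R]_4 => x *m Q) u').
    exact: differentiable_mulmxr.
  exact: smooth_on_differentiable oO _ Ox.
apply: (@smooth_on_stable _ F); last 1 first.
- by exists I, c, u; split => //; apply/funext => x; rewrite fct_sumE.
- exact: open_mulmxr.
- move=> f x [J [d [w [sw ->]]]] Ox; apply: differentiable_fin_sum => i.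
  by apply: differentiableM; [exact: differentiable_cst|exact: dF].
move=> f j [J [d [w [sw ->]]]].
exists (fun x => \sum_(p : J * 'I_4) d p.1 * Q j p.2 * partial p.2 (w p.1) (x *m Q)).
  exists (J * 'I_4)%type, (fun p => d p.1 * Q j p.2), (fun p => partial p.2 (w p.1)).
  split; first by move=> p; exact: smooth_on_partial.
  by apply/funext => x; rewrite fct_sumE.
move=> x; rewrite inE /= => Ox.
rewrite [LHS]derive_fin_sum; last first.
  move=> i; apply: diff_derivable.
  by apply: differentiableM; [exact: differentiable_cst|exact: dF].
rewrite (eq_bigr (fun p => d p.1 * (Q j p.2 * partial p.2 (w p.1) (x *m Q)))); last first.
  by move=> p _; rewrite mulrA.
rewrite -(pair_bigA _ (fun i k => d i * (Q j k * partial k (w i) (x *m Q)))) /=.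
apply: eq_bigr => i _; rewrite -mulr_sumr.
have dw := dF _ _ (sw i) Ox.
rewrite (@deriveZ _ _ _ (fun x => w i (x *m Q)) (d i)); last exact: diff_derivable.
congr (_ * _).
rewrite (@derive_comp_rV _ _ _ (w i) (fun x : 'rV[R]_4 => x *m Q)).
- apply: eq_bigr => k _; congr (_ * _).
  have := derive_mulmxr Q x (delta_mx ord0 j).
  rewrite derive_mx; last exact/diff_derivable/differentiable_mulmxr.
  by move=> /rowP/(_ k); rewrite mxE -rowE mxE.
- exact: smooth_on_differentiable oO _ Ox.
- exact: differentiable_mulmxr.
Qed.

End Smooth.

(** * Linear changes of charts *)

Section Charts.
Variables (R : realType) (M : topologicalType).
Implicit Types phi psi : chart R M.

Lemma open_cimage phi (U : set M) : open U -> open (cimage phi U).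
Proof.
rewrite !openE => oU x [p [pc pU] <-].
have nimg : nbhs (cmap phi p) (cmap phi @` cdom phi).
  by apply: open_nbhs_nbhs; split; [exact: cimg_open|exists p].
have nU : nbhs (cmap phi p) (cinv phi @^-1` U).
  by apply: (cinv_continuous pc); rewrite cmapK //; exact: oU.
apply: filterS2 nimg nU => y [q qc <-] Uq.
by exists q => //; split => //; rewrite -(cmapK qc).
Qed.

Lemma cimageT phi : cimage phi setT = cmap phi @` cdom phi.
Proof. by rewrite /cimage setIT. Qed.

Lemma cinv_cdom phi x : (cmap phi @` cdom phi) x ->
  cdom phi (cinv phi x) /\ cmap phi (cinv phi x) = x.
Proof. by move=> [q qc <-]; rewrite cmapK. Qed.

(* The coordinates [x *m P] on [W], for [x] the coordinates of [phi]. *)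
Section LinearChart.
Variables (phi : chart R M) (W : set M) (Q P : 'M[R]_4).
Hypotheses (oW : open W) (Wphi : W `<=` cdom phi) (QP : Q *m P = 1%:M).

Let PQ : P *m Q = 1%:M. Proof. exact: mulmx1C. Qed.

Let lmap (q : M) := cmap phi q *m P.
Let linv (x : 'rV[R]_4) := cinv phi (x *m Q).

Let limg_open : open (lmap @` W).
Proof.
have -> : lmap @` W = [set x | cimage phi W (x *m Q)].
  apply/seteqP; split => x /=.
    move=> [q Wq <-]; rewrite /lmap -mulmxA PQ mulmx1; exists q => //.
    by split=> //; exact: Wphi.
  by move=> [q [_ Wq] E]; exists q => //; rewrite /lmap E -mulmxA QP mulmx1.
exact/open_mulmxr/open_cimage.
Qed.

Let lmapK p : W p -> linv (lmap p) = p.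
Proof. by move=> /Wphi pc; rewrite /linv /lmap -mulmxA PQ mulmx1 cmapK. Qed.

Let lmap_continuous p : W p -> {for p, continuous lmap}.
Proof.
move=> /Wphi pc.
apply: (@continuous_comp _ _ _ (cmap phi) (fun x : 'rV[R]_4 => x *m P)).
  exact: cmap_continuous.
exact/differentiable_continuous/differentiable_mulmxr.
Qed.

Let linv_continuous p : W p -> {for lmap p, continuous linv}.
Proof.
move=> /Wphi pc.
apply: (@continuous_comp _ _ _ (fun x : 'rV[R]_4 => x *m Q) (cinv phi)).
  exact/differentiable_continuous/differentiable_mulmxr.
by rewrite /lmap -mulmxA PQ mulmx1; exact: cinv_continuous.
Qed.

Definition linear_chart : chart R M :=
  Chart oW limg_open lmapK lmap_continuous linv_continuous.

(** By maximality of the atlas it suffices to check transitions. Those out of the new chart are old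
    ones precomposed with multiplication by [Q]; those into it are combinations of old ones with
    coefficients from a column of [P]. *)
Lemma linear_chart_atlas (A : set (chart R M)) :
  connected_manifold A -> A phi -> A linear_chart.
Proof.
move=> hM Aphi; apply: (atlas_maximal hM) => psi Apsi.
have [s1 s2] := atlas_compatible hM Aphi Apsi.
split=> i.
  have := @smooth_on_linear R (cimage phi (cdom psi)) Q 'I_1 (fun=> 1)
    (fun=> transition phi psi i).
  move=> /(_ (open_cimage (cdom_open psi)) (fun=> s1 i)).
  rewrite (_ : (fun _ => _) = transition linear_chart psi i); last first.
    by apply/funext => x; rewrite big_ord1 mul1r.
  apply: smooth_on_sub => _ [q [Wq qc] <-] /=.
  by exists q; rewrite /lmap -?mulmxA ?PQ ?mulmx1 //; split => //; exact: Wphi.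
have := @smooth_on_linear R (cimage psi (cdom phi)) 1%:M 'I_4 (fun k => P k i)
  (transition psi phi).
move=> /(_ (open_cimage (cdom_open phi)) s2).
rewrite (_ : (fun _ => _) = transition psi linear_chart i); last first.
  apply/funext => x; rewrite /transition mxE; apply: eq_bigr => k _.
  by rewrite mulmx1 mulrC.
apply: smooth_on_sub => _ [q [qc Wq] <-] /=.
by rewrite mulmx1; exists q => //; split => //; exact: Wphi.
Qed.

(** The transpose arises because coordinates are rows, multiplied by [Q] on the right, while a
    Jacobian matrix acts on columns. *)
Lemma jacobi_linear_chart q : W q -> jacobi linear_chart phi q = Q^T.
Proof.
move=> Wq; apply/matrixP => i j; rewrite !mxE.
rewrite (@partial_near_eq _ _ (fun y => (y *m Q) ord0 i)).
  have := derive_mulmxr Q (cmap linear_chart q) (delta_mx ord0 j).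
  rewrite derive_mx; last exact/diff_derivable/differentiable_mulmxr.
  by move=> /rowP/(_ i); rewrite mxE -rowE mxE.
apply: open_near limg_open _ _; first by exists q.
move=> y [p Wp <-]; rewrite /transition /= /linv /lmap -mulmxA PQ mulmx1.
by rewrite cmapK //; exact: Wphi.
Qed.

End LinearChart.
End Charts.

(** * The two chiral forms *)

Section Algebra.
Variable R : realType.
Implicit Types (J g B : 'M[R]_4) (a b c d e f : R).

Lemma forall_ord4 (P : 'I_4 -> Prop) :
  P (inord 0) -> P (inord 1) -> P (inord 2) -> P (inord 3) -> forall i, P i.
Proof.
move=> P0 P1 P2 P3 i; rewrite -(inord_val i).
by case: i => [[|[|[|[|//]]]]].
Qed.

Lemma sum_ord4 (V : nmodType) (F : 'I_4 -> V) :
  \sum_i F i = F (inord 0) + F (inord 1) + F (inord 2) + F (inord 3).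
Proof.
rewrite !big_ord_recl big_ord0 addr0 !addrA.
by congr (F _ + F _ + F _ + F _); apply/val_inj; rewrite /= inordK.
Qed.

Lemma sum_ord4_neq0 (V : nmodType) (F : 'I_4 -> V) :
  \sum_(i < 4 | i != ord0) F i = F (inord 1) + F (inord 2) + F (inord 3).
Proof.
rewrite big_mkcond !big_ord_recl big_ord0 /= add0r addr0 !addrA.
by congr (F _ + F _ + F _); apply/val_inj; rewrite /= inordK.
Qed.

Lemma mx_of_rowsE (s : seq (seq R)) k l : (k < 4)%N -> (l < 4)%N ->
  mx_of_rows s (inord k) (inord l) = nth 0 (nth [::] s k) l.
Proof. by move=> k4 l4; rewrite mxE !inordK. Qed.

Lemma bilin_delta B i j : bilin B (delta_mx i ord0) (delta_mx j ord0) = B i j.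
Proof. by rewrite /bilin trmx_delta -rowE -colE !mxE. Qed.

Lemma bilin_mulmx B J (X Y : 'cV[R]_4) :
  bilin B (J *m X) (J *m Y) = bilin (J^T *m B *m J) X Y.
Proof. by rewrite /bilin trmx_mul !mulmxA. Qed.

Lemma bilin_inj B C : (forall X Y, bilin B X Y = bilin C X Y) -> B = C.
Proof. by move=> E; apply/matrixP => i j; rewrite -!bilin_delta. Qed.

(** Multiplying the compatibility relation by [J] on the right turns its left side into
    [eps *: (J^T *m g)]; then [eps] cancels. *)
Lemma fundamental_form_skew eps g J : eps != 0 -> g^T = g -> J *m J = eps%:M ->
  J^T *m g *m J = - eps *: g -> (g *m J)^T = - (g *m J).
Proof.
move=> e0 sg JJ compat; rewrite trmx_mul sg.
apply: (scalerI e0); rewrite scalerN -scaleNr.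
by rewrite [RHS]scalemxAl -compat -[RHS]mulmxA JJ mul_mx_scalar.
Qed.

(** The boolean carries the handedness, [true] for left, so that the left and right cases share
    their proofs; [chiral_sign] is the sign by which they differ. *)
Definition chiralJ (s : bool) a b c := if s then leftJ a b c else rightJ a b c.

Definition chiral_sign (s : bool) : R := if s then 1 else -1.

(** The matrix of the fundamental form in terms of [f] itself: for [g = h *: stdG] and parameters
    [f1 / h], [f2 / h], [f3 / h], the factor [h] cancels. *)
Definition chiral_form (s : bool) (u : pquat R) : 'M[R]_4 :=
  stdG R *m chiralJ s (u ord0 (inord 1)) (u ord0 (inord 2)) (u ord0 (inord 3)).

(* When [stdG *m J] is antisymmetric, J is the sum of a [leftJ] and a [rightJ]; this is
   the difference of the squared Euclidean norms of their parameters (a, b, c). *)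
Definition chirality J : R :=
  J (inord 0) (inord 2) * J (inord 1) (inord 3)
  - J (inord 0) (inord 1) * J (inord 2) (inord 3)
  - J (inord 0) (inord 3) * J (inord 1) (inord 2).

(** The hypotheses are entries of [J *m J = eps%:M]. Given the first three conclusions, the last one
    says that the left and right parts of [J] have norms whose product is zero. *)
Lemma chirality_square a b c d e f eps :
  b ^+ 2 + c ^+ 2 - a ^+ 2 = eps -> d ^+ 2 + e ^+ 2 - a ^+ 2 = eps ->
  b ^+ 2 + d ^+ 2 - f ^+ 2 = eps -> c ^+ 2 + e ^+ 2 - f ^+ 2 = eps ->
  b * d + c * e = 0 -> a * d - c * f = 0 -> a * e + b * f = 0 ->
  [/\ d ^+ 2 = c ^+ 2, e ^+ 2 = b ^+ 2, f ^+ 2 = a ^+ 2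
    & (b * e - a * f - c * d) ^+ 2 = (a ^+ 2 + b ^+ 2 + c ^+ 2) ^+ 2].
Proof.
move=> E0 E1 E2 E3 E4 E5 E6.
have fa : f ^+ 2 = a ^+ 2 by lra.
have eb : e ^+ 2 = b ^+ 2 by lra.
have dc : d ^+ 2 = c ^+ 2 by lra.
split => //.
(* The multiples of the three off-diagonal relations are chosen so that, once these vanish, only
   even powers remain. *)
have -> : (b * e - a * f - c * d) ^+ 2 =
    (b ^+ 2 * e ^+ 2 + a ^+ 2 * f ^+ 2 + c ^+ 2 * d ^+ 2)
    + 2 * (b ^+ 2 * f ^+ 2 + c ^+ 2 * f ^+ 2 + c ^+ 2 * e ^+ 2)
    - 2 * (b * f) * (a * e + b * f) + 2 * (c * f) * (a * d - c * f)
    - 2 * (c * e) * (b * d + c * e) by ring.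
by rewrite E4 E5 E6 fa eb dc; ring.
Qed.

(** Positivity selects the root [chiral_sign s * S = N]. Four times the squared norm of the part of
    opposite handedness is then a sum of three squares equal to [2 * N - 2 * N], so each square
    vanishes. *)
Lemma chiral_scalars (s : bool) a b c d e f :
  d ^+ 2 = c ^+ 2 -> e ^+ 2 = b ^+ 2 -> f ^+ 2 = a ^+ 2 ->
  (b * e - a * f - c * d) ^+ 2 = (a ^+ 2 + b ^+ 2 + c ^+ 2) ^+ 2 ->
  0 < chiral_sign s * (b * e - a * f - c * d) ->
  [/\ d = - chiral_sign s * c, e = chiral_sign s * b & f = - chiral_sign s * a].
Proof.
set N := a ^+ 2 + b ^+ 2 + c ^+ 2; set S := b * e - a * f - c * d.
move=> dc eb fa SN pos.
have N0 : 0 <= N by rewrite /N !addr_ge0 // sqr_ge0.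
have sS : chiral_sign s * S = N.
  have : (chiral_sign s * S) ^+ 2 = N ^+ 2.
    by rewrite exprMn SN /chiral_sign; case: s {pos}; rewrite ?sqrrN expr1n mul1r.
  move/eqP; rewrite eqrXn2 //; [by move/eqP|exact: ltW].
have z : (f + chiral_sign s * a) ^+ 2 + (e - chiral_sign s * b) ^+ 2
    + (d + chiral_sign s * c) ^+ 2 = 0.
  have s2 : chiral_sign s ^+ 2 = 1.
    by rewrite /chiral_sign; case: s {pos sS}; rewrite ?sqrrN expr1n.
  have -> : (f + chiral_sign s * a) ^+ 2 + (e - chiral_sign s * b) ^+ 2
    + (d + chiral_sign s * c) ^+ 2 = f ^+ 2 + e ^+ 2 + d ^+ 2 + chiral_sign s ^+ 2 * N
       - 2 * (chiral_sign s * S) by rewrite /S /N; ring.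
  by rewrite sS s2 fa eb dc /N; ring.
have q1 := sqr_ge0 (f + chiral_sign s * a).
have q2 := sqr_ge0 (e - chiral_sign s * b).
have q3 := sqr_ge0 (d + chiral_sign s * c).
have zero (t : R) : t ^+ 2 <= 0 -> t = 0.
  by move=> t0; apply/eqP; rewrite -sqrf_eq0 eq_le t0 sqr_ge0.
have /zero z1 : (f + chiral_sign s * a) ^+ 2 <= 0 by lra.
have /zero z2 : (e - chiral_sign s * b) ^+ 2 <= 0 by lra.
have /zero z3 : (d + chiral_sign s * c) ^+ 2 <= 0 by lra.
by split; lra.
Qed.

Lemma stdG_mulmx J i j : (stdG R *m J) i j = stdG R i i * J i j.
Proof.
rewrite mxE (bigD1 i) //= big1 ?addr0 // => k ki.
suff -> : stdG R i k = 0 by rewrite mul0r.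
move: i k ki; apply: forall_ord4; apply: forall_ord4 => //;
  by rewrite ?eqxx // mx_of_rowsE.
Qed.

(** * The structure [J] at a point where the metric is a multiple of the standard one *)

Section ConformalFrame.
Variables (eps h : R) (g J : 'M[R]_4).
Hypotheses (eps_neq0 : eps != 0) (h_gt0 : 0 < h) (gE : g = h *: stdG R)
  (JJ : J *m J = eps%:M) (gJ_skew : (g *m J)^T = - (g *m J)).

Let a := J (inord 0) (inord 1).
Let b := J (inord 0) (inord 2).
Let c := J (inord 0) (inord 3).
Let d := J (inord 1) (inord 2).
Let e := J (inord 1) (inord 3).
Let f := J (inord 2) (inord 3).

Let skew i j : stdG R j j * J j i = - (stdG R i i * J i j).
Proof.
have hN0 : h != 0 by rewrite gt_eqF.
move: gJ_skew; rewrite gE -scalemxAl linearZ /= -scalerN => /(scalerI hN0).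
by move=> /matrixP/(_ i j); rewrite mxE [RHS]mxE !stdG_mulmx.
Qed.

Let JE : J = mx_of_rows [:: [:: 0; a; b; c]; [:: - a; 0; d; e];
                            [:: b; d; 0; f]; [:: c; e; - f; 0]].
Proof.
have s00 := skew (inord 0) (inord 0); have s11 := skew (inord 1) (inord 1).
have s22 := skew (inord 2) (inord 2); have s33 := skew (inord 3) (inord 3).
have s01 := skew (inord 0) (inord 1); have s02 := skew (inord 0) (inord 2).
have s03 := skew (inord 0) (inord 3); have s12 := skew (inord 1) (inord 2).
have s13 := skew (inord 1) (inord 3); have s23 := skew (inord 2) (inord 3).
rewrite !mx_of_rowsE //= in s00 s11 s22 s33 s01 s02 s03 s12 s13 s23.
apply/matrixP; apply: forall_ord4; apply: forall_ord4;
  rewrite mx_of_rowsE //= /a /b /c /d /e /f; lra.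
Qed.

Let square : [/\ b ^+ 2 + c ^+ 2 - a ^+ 2 = eps, d ^+ 2 + e ^+ 2 - a ^+ 2 = eps,
  b ^+ 2 + d ^+ 2 - f ^+ 2 = eps & c ^+ 2 + e ^+ 2 - f ^+ 2 = eps] /\
  [/\ b * d + c * e = 0, a * d - c * f = 0 & a * e + b * f = 0].
Proof.
have q k l : (k < 4)%N -> (l < 4)%N ->
    J (inord k) (inord 0) * J (inord 0) (inord l)
    + J (inord k) (inord 1) * J (inord 1) (inord l)
    + J (inord k) (inord 2) * J (inord 2) (inord l)
    + J (inord k) (inord 3) * J (inord 3) (inord l)
    = (k == l)%:R * eps.
  move=> k4 l4; have := JJ => /matrixP/(_ (inord k) (inord l)).
  by rewrite mxE sum_ord4 mxE -val_eqE /= !inordK // mulr_natl.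
have := (q 0 0 isT isT, q 1 1 isT isT, q 2 2 isT isT, q 3 3 isT isT,
  q 0 1 isT isT, q 0 2 isT isT, q 0 3 isT isT)%N.
rewrite JE !mx_of_rowsE //= => -[[[[[[q00 q11] q22] q33] q01] q02] q03].
by do ![split]; lra.
Qed.

(** A zero value would force [a = b = c = 0], against the (0,0) entry
    [b ^+ 2 + c ^+ 2 - a ^+ 2 = eps] of the square of [J]. Thus every point has a definite
    handedness. *)
Lemma chirality_neq0 : chirality J != 0.
Proof.
have [[E0 E1 E2 E3] [E4 E5 E6]] := square.
have [_ _ _] := chirality_square E0 E1 E2 E3 E4 E5 E6.
rewrite -[X in X ^+ 2]/(chirality J) => pf2.
apply/eqP => pf0; move/eqP: pf2; rewrite pf0 expr0n /= eq_sym sqrf_eq0 => /eqP N0.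
have a0 := sqr_ge0 a; have b0 := sqr_ge0 b; have c0 := sqr_ge0 c.
by move/eqP: eps_neq0; apply; lra.
Qed.

Lemma chiralJ_of_chirality (s : bool) :
  0 < chiral_sign s * chirality J -> J = chiralJ s a b c.
Proof.
have [[E0 E1 E2 E3] [E4 E5 E6]] := square.
have [dc eb fa pf2] := chirality_square E0 E1 E2 E3 E4 E5 E6.
rewrite -[X in _ * X]/(b * e - a * f - c * d).
move=> /(chiral_scalars dc eb fa pf2)[Ed Ee Ef].
rewrite {1}JE Ed Ee Ef /chiralJ /chiral_sign.
by case: s {Ed Ee Ef}; rewrite ?mulN1r ?opprK ?mul1r.
Qed.

Lemma chiral_norm : a ^+ 2 - b ^+ 2 - c ^+ 2 = - eps.
Proof. by have [[E0 _ _ _] _] := square; lra. Qed.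
End ConformalFrame.

(** The pointwise algebra behind the regularity equations, with [P i] in the role of the [i]-th
    partial derivative of [f]. Up to sign, the components (1,2,3), (0,2,3), (0,1,3), (0,1,2) of the
    exterior derivative are the components 0, 1, 2, 3 of the Dirac-type operator. *)
Lemma chiral_form_tensor (s : bool) (P : 'I_4 -> pquat R) :
  (forall i, P i ord0 (inord 0) = 0) ->
  (forall i j k, chiral_form s (P i) j k + chiral_form s (P j) k i
     + chiral_form s (P k) i j = 0) <->
  P ord0 + \sum_(j < 4 | j != ord0)
    (if s then pqmul (pqi R j) (P j) else pqmul (P j) (pqi R j)) = 0.
Proof.
move=> P0.
rewrite sum_ord4_neq0.
have -> : (ord0 : 'I_4) = inord 0 by apply/val_inj; rewrite /= inordK.
have form i j : chiral_form s (P i) j = fun k => nth 0 (nth [::]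
  [:: [:: 0; - P i ord0 (inord 1); - P i ord0 (inord 2); - P i ord0 (inord 3)];
      [:: P i ord0 (inord 1); 0; chiral_sign s * P i ord0 (inord 3);
          - chiral_sign s * P i ord0 (inord 2)];
      [:: P i ord0 (inord 2); - chiral_sign s * P i ord0 (inord 3); 0;
          - chiral_sign s * P i ord0 (inord 1)];
      [:: P i ord0 (inord 3); chiral_sign s * P i ord0 (inord 2);
          chiral_sign s * P i ord0 (inord 1); 0]] j) k.
  apply/funext => k; rewrite /chiral_form stdG_mulmx /chiralJ /chiral_sign.
  by case: s; move: j k; apply: forall_ord4; apply: forall_ord4;
      rewrite !mx_of_rowsE // !inordK //=; ring.
pose p (i j : nat) : R := P (inord i) ord0 (inord j).
set S := (X in X = 0).
have SE k : (k < 4)%N -> S ord0 (inord k) = nth 0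
    [:: p 2%N 2%N + p 3%N 3%N - p 1%N 1%N;
        p 0%N 1%N + chiral_sign s * (p 3%N 2%N - p 2%N 3%N);
        p 0%N 2%N + chiral_sign s * (p 3%N 1%N - p 1%N 3%N);
        p 0%N 3%N + chiral_sign s * (p 1%N 2%N - p 2%N 1%N)] k.
  rewrite /S /chiral_sign; case: s {form S} => k4;
    rewrite !mxE -!val_eqE /= !inordK //= !P0;
    case: k k4 => [|[|[|[|//]]]] _ /=; rewrite ?P0 /p; ring.
split=> [dO|S0].
  have := (dO (inord 0) (inord 1) (inord 2), dO (inord 0) (inord 1) (inord 3),
    dO (inord 0) (inord 2) (inord 3), dO (inord 1) (inord 2) (inord 3)).
  rewrite !form !inordK //= -!/(p _ _) => -[[[d012 d013] d023] d123].
  apply/rowP; apply: forall_ord4; rewrite SE // mxE /=;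
    by move: d012 d013 d023 d123; rewrite /chiral_sign; case: (s) => *; lra.
have e k : (k < 4)%N -> S ord0 (inord k) = 0 by rewrite S0 mxE.
have := (e 0 isT, e 1 isT, e 2 isT, e 3 isT)%N; rewrite !SE //= {e S0 SE S}.
move=> [[[e0 e1] e2] e3]; have pP i j : P (inord i) ord0 (inord j) = p i j by [].
clearbody p; move: e0 e1 e2 e3 form; rewrite /chiral_sign => e0 e1 e2 e3 form.
(* All 64 index triples are checked; antisymmetry of the form reduces each to one of the four
   components or to zero. *)
apply: forall_ord4; apply: forall_ord4; apply: forall_ord4;
  rewrite !form !inordK //= ?pP; move: e0 e1 e2 e3; clear; case: s => *; lra.
Qed.
End Algebra.

(** * Pullback of closed 2-forms *)

Section Pullback.
Variable R : realType.

Lemma derive_triple (V : normedModType R) (a b c : V -> R) (x v : V) :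
  differentiable a x -> differentiable b x -> differentiable c x ->
  'D_v (fun y => a y * b y * c y) x =
    'D_v a x * b x * c x + a x * 'D_v b x * c x + a x * b x * 'D_v c x.
Proof.
move=> da db dc.
have da' : derivable a x v by exact: diff_derivable.
have db' : derivable b x v by exact: diff_derivable.
have dc' : derivable c x v by exact: diff_derivable.
apply: etrans (deriveM (derivableM da' db') dc') _; rewrite (deriveM da' db').
have leibniz (p q r p' q' r' : R) :
  p * q * r' + r * (p * q' + q * p') = p' * q * r + p * q' * r + p * q * r' by ring.
exact: leibniz.
Qed.

Let beta n (B : 'I_n -> 'I_n -> R) (u v : 'I_n -> R) : R :=
  \sum_l \sum_m u l * B l m * v m.

Let betaN n (B : 'I_n -> 'I_n -> R) u v :
  (forall l m, B m l = - B l m) -> beta B u v = - beta B v u.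
Proof.
move=> skew; rewrite /beta exchange_big -sumrN; apply: eq_bigr => l _.
rewrite -sumrN; apply: eq_bigr => m _.
by rewrite skew mulrN mulNr mulrAC -mulrA mulrC.
Qed.

(** Renaming the summation indices gives all three sums the common factor [v l * u k * w m],
    multiplied by the three cyclic permutations of [D]. *)
Let cyclic_sum n (D : 'I_n -> 'I_n -> 'I_n -> R) (u v w : 'I_n -> R) :
  (forall n l m, D n l m + D l m n + D m n l = 0) ->
  let T u v w := \sum_l \sum_m \sum_n v l * (u n * D n l m) * w m in
  T u v w + T v w u + T w u v = 0.
Proof.
move=> D0 T.
have -> : T v w u = \sum_l \sum_m \sum_n v l * (u n * D l m n) * w m.
  rewrite /T.
  under eq_bigr do rewrite exchange_big.
  rewrite exchange_big; apply: eq_bigr => l _; apply: eq_bigr => m _.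
  by apply: eq_bigr => k _; ring.
have -> : T w u v = \sum_l \sum_m \sum_n v l * (u n * D m n l) * w m.
  rewrite /T exchange_big; apply: eq_bigr => l _.
  rewrite exchange_big; apply: eq_bigr => m _.
  by apply: eq_bigr => k _; ring.
rewrite -!big_split big1 // => l _; rewrite -!big_split big1 // => m _.
rewrite -!big_split big1 // => k _ /=.
by rewrite -[RHS](mulr0 (v l * u k * w m)) -(D0 k l m); ring.
Qed.

(** The exterior derivative commutes with pullback by [tau]. Closedness and antisymmetry of [B] are
    asked only at [tau x], so a different chart may serve at each point. *)
Lemma pullback_closed (O : set 'rV[R]_4) (x : 'rV[R]_4)
    (t : 'I_4 -> 'rV[R]_4 -> R) (B w : 'I_4 -> 'I_4 -> 'rV[R]_4 -> R) :
  let tau y : 'rV[R]_4 := \row_l t l y in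
  open O -> O x -> (forall l, smooth_on O (t l)) ->
  (forall l m, differentiable (B l m) (tau x)) ->
  (forall l m, B m l (tau x) = - B l m (tau x)) ->
  (forall n l m, partial n (B l m) (tau x) + partial l (B m n) (tau x)
     + partial m (B n l) (tau x) = 0) ->
  (forall j k y, O y -> w j k y =
     \sum_l \sum_m partial j (t l) y * B l m (tau y) * partial k (t m) y) ->
  forall i j k, partial i (w j k) x + partial j (w k i) x + partial k (w i j) x = 0.
Proof.
(* [a], [b], [c] are the second-derivative terms: symmetry of the Hessians and
   antisymmetry of [B] make each occur twice, with opposite signs. *)
have cancel (a b c p q r : R) : p + q + r = 0 ->
    a + p - b + (c + q - a) + (b + r - c) = 0.
  by move=> E; rewrite -[RHS]E; ring.
move=> tau oO Ox st dB skew closed wE i j k.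
have dt l : differentiable (t l) x by exact: smooth_on_differentiable oO _ Ox.
have dp a l : differentiable (partial a (t l)) x.
  by apply: smooth_on_differentiable oO _ Ox; exact: smooth_on_partial.
have dtau : differentiable tau x.
  apply: differentiable_rV => l.
  by rewrite (_ : (fun y => _) = t l) //; apply/funext => y; rewrite mxE.
have dBt l m : differentiable (B l m \o tau) x by exact: differentiable_comp.
pose T a l := partial a (t l) x.
pose H a b l := partial a (partial b (t l)) x.
pose D n l m := partial n (B l m) (tau x).
pose B0 l m := B l m (tau x).
(* Product rule: the derivative falls on the first Jacobian factor, on [B] through the chain rule,
   or on the second Jacobian factor. *)
have step a b c : partial a (w b c) x = beta B0 (H a b) (T c)
   + \sum_l \sum_m \sum_n T b l * (T a n * D n l m) * T c m
   + beta B0 (T b) (H a c).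
  rewrite (@partial_near_eq _ _ (fun y =>
     \sum_l \sum_m partial b (t l) y * (B l m \o tau) y * partial c (t m) y));
    last first.
    by apply: open_near oO Ox _ => y; exact: wE.
  pose term l m y := partial b (t l) y * (B l m \o tau) y * partial c (t m) y.
  have -> : (fun y => \sum_l \sum_m term l m y) = \sum_l \sum_m term l m.
    by apply/funext => y; rewrite fct_sumE; apply: eq_bigr => l _; rewrite fct_sumE.
  have d3 l m : differentiable (term l m) x.
    by apply: differentiableM => //; apply: differentiableM.
  rewrite /partial derive_fin_sum; last first.
    by move=> l; apply/diff_derivable/differentiable_fin_sum => m; exact: d3.
  rewrite /beta -!big_split; apply: eq_bigr => l _.
  rewrite derive_fin_sum; last by move=> m; exact/diff_derivable/d3.
  rewrite -!big_split; apply: eq_bigr => m _ /=.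
  rewrite (derive_triple _ (dp b l) (dBt l m) (dp c m)) /=; congr (_ + _ + _) => //.
  rewrite -mulr_suml -mulr_sumr; congr (_ * _ * _).
  rewrite derive_comp_rV //; apply: eq_bigr => n _; congr (_ * _).
  by rewrite (_ : (fun y => tau y ord0 n) = t n) //; apply/funext => y; rewrite mxE.
rewrite !step.
have sym a b : H a b = H b a.
  by apply/funext => l; exact: smooth_on_schwarz oO (st l) Ox.
have skewB u v : beta B0 u v = - beta B0 v u by exact: betaN.
rewrite (skewB (T j) (H i k)) (skewB (T k) (H j i)) (skewB (T i) (H k j)).
rewrite (sym j i) (sym k j) (sym k i).
exact/cancel/(@cyclic_sum _ D).
Qed.
End Pullback.

(** * The fundamental form *)

Lemma chiral_form_linear (R : realType) (s : bool) (a : R) (u v : pquat R) :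
  chiral_form s (a *: u + v) = a *: chiral_form s u + chiral_form s v.
Proof.
have E (w : pquat R) : chiral_form s w = stdG R *m
  chiralJ s (w ord0 (inord 1)) (w ord0 (inord 2)) (w ord0 (inord 3)) by [].
have uv l : (a *: u + v) ord0 l = a * u ord0 l + v ord0 l by rewrite !mxE.
apply/matrixP => i j; rewrite [RHS]mxE [X in _ = X + _]mxE !E !stdG_mulmx !uv.
rewrite /chiralJ; case: s {E}; move: i j; apply: forall_ord4; apply: forall_ord4;
  rewrite !mx_of_rowsE //=; ring.
Qed.

(** Each entry of [chiral_form s u] is a fixed linear function of [u], so it commutes with
    differentiation. *)
Lemma chiral_form_partial (R : realType) (s : bool) (F : 'rV[R]_4 -> pquat R) x i j k :
  differentiable F x ->
  partial i (fun y => chiral_form s (F y) j k) x = chiral_form s (partial i F x) j k.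
Proof.
move=> dF.
have E (u : pquat R) : chiral_form s u j k =
    \sum_l u ord0 l * chiral_form s (delta_mx ord0 l) j k.
  have f0 : chiral_form s (0 : pquat R) = 0.
    by have := chiral_form_linear s (-1) 0 (0 : pquat R); rewrite !scaleN1r !addNr.
  pose ell (w : pquat R) := chiral_form s w j k.
  have ellD : {morph ell : w z / w + z}.
    move=> w z; have := chiral_form_linear s 1 w z.
    by rewrite !scale1r /ell => ->; rewrite mxE.
  have ell0 : ell 0 = 0 by rewrite /ell f0 mxE.
  rewrite -/(ell u) {1}[u]row_sum_delta (big_morph ell ellD ell0).
  apply: eq_bigr => l _; rewrite -[X in ell X]addr0 /ell chiral_form_linear f0 addr0.
  by rewrite mxE.
have dFl l : differentiable (fun y => F y ord0 l) x.
  apply: (@differentiable_comp _ _ _ _ F (fun u : 'rV[R]_4 => u ord0 l)) => //.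
  exact: differentiable_coord.
have -> : (fun y => chiral_form s (F y) j k) =
    \sum_l (fun y => F y ord0 l * chiral_form s (delta_mx ord0 l) j k).
  by apply/funext => y; rewrite fct_sumE E.
rewrite /partial derive_fin_sum; last first.
  move=> l; apply: diff_derivable.
  by apply: differentiableM => //; exact: differentiable_cst.
rewrite E; apply: eq_bigr => l _.
rewrite derive_mx; last exact: diff_derivable.
rewrite [X in _ = X * _]mxE (@deriveMr _ _ (fun y => F y ord0 l)).
  exact: mulrC.
exact: diff_derivable.
Qed.

Section Manifold.
Variables (R : realType) (eps : R) (M : topologicalType) (A : set (chart R M)).
Variables (g J : components R M).
Hypotheses (heps : eps = 1 \/ eps = -1) (hM : connected_manifold A)
  (hgJ : almost_hermitian eps A g J).

Let eps_neq0 : eps != 0.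
Proof. by case: heps => ->; rewrite ?oppr_eq0 oner_eq0. Qed.

Lemma Omega_compE phi i j x : Omega_comp g J phi i j x =
  (g phi (cinv phi x) *m J phi (cinv phi x)) i j.
Proof. by rewrite -bilin_delta /Omega_comp /Omega /bilin !mulmxA. Qed.

Lemma Omega_comp_differentiable phi i j x :
  A phi -> cimage phi setT x -> differentiable (Omega_comp g J phi i j) x.
Proof.
move=> Aphi Vx; have oV : open (cimage phi setT) by exact: open_cimage openT.
have -> : Omega_comp g J phi i j =
    \sum_k (fun y => g phi (cinv phi y) i k * J phi (cinv phi y) k j).
  by apply/funext => y; rewrite fct_sumE Omega_compE mxE.
apply: differentiable_fin_sum => k; apply: differentiableM.
  exact: smooth_on_differentiable oV ((hermitian_metric hgJ).1.1 _ Aphi i k) Vx.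
exact: smooth_on_differentiable oV ((hermitian_tensor hgJ).1 _ Aphi k j) Vx.
Qed.

Lemma Omega_skew phi q : A phi -> cdom phi q ->
  (g phi q *m J phi q)^T = - (g phi q *m J phi q).
Proof.
move=> Aphi qc; apply: (@fundamental_form_skew _ eps) => //.
- by have [] := (hermitian_metric hgJ).2 phi q Aphi qc.
- exact: hermitian_square hgJ _ _ Aphi qc.
- apply: bilin_inj => X Y.
  rewrite -bilin_mulmx (hermitian_compatible hgJ Aphi qc).
  by rewrite /bilin -scalemxAr -scalemxAl [RHS]mxE.
Qed.

Lemma Omega_change phi psi q : A phi -> A psi -> cdom phi q -> cdom psi q ->
  g phi q *m J phi q =
    (jacobi phi psi q)^T *m (g psi q *m J psi q) *m jacobi phi psi q.
Proof.
move=> Aphi Apsi pc sc.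
rewrite ((hermitian_metric hgJ).1.2 _ _ _ Aphi Apsi pc sc) //.
by rewrite -mulmxA ((hermitian_tensor hgJ).2 _ _ _ Aphi Apsi pc sc) // !mulmxA.
Qed.

(** Since the matrix of [Omega] is [chiral_form s (F y)] on the whole image of the chart, its
    derivatives at [x] are chiral forms of those of [F], to which [chiral_form_tensor] applies. *)
Lemma kahler_chart_regular phi (s : bool) (F : 'rV[R]_4 -> pquat R) x :
  cimage phi setT x -> differentiable F x ->
  (forall y, F y ord0 (inord 0) = 0) ->
  (forall y, cimage phi setT y ->
    g phi (cinv phi y) *m J phi (cinv phi y) = chiral_form s (F y)) ->
  (forall i j k, partial i (Omega_comp g J phi j k) x
     + partial j (Omega_comp g J phi k i) x
     + partial k (Omega_comp g J phi i j) x = 0) <->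
  (if s then DL F x else DR F x) = 0.
Proof.
move=> Vx dF F0 FE.
have pE i j k : partial i (Omega_comp g J phi j k) x = chiral_form s (partial i F x) j k.
  rewrite -chiral_form_partial //; apply: partial_near_eq.
  have oV : open (cimage phi setT) by exact: open_cimage openT.
  by apply: open_near oV Vx _ => y Vy; rewrite Omega_compE FE.
have P0 i : partial i F x ord0 (inord 0) = 0.
  rewrite /partial derive_mx; last exact: diff_derivable.
  rewrite mxE (_ : (fun y => _) = cst 0) ?derive_cst //.
  by apply/funext => y; rewrite F0.
have -> : (if s then DL F x else DR F x) = partial ord0 F x + \sum_(j < 4 | j != ord0)
    (if s then pqmul (pqi R j) (partial j F x) else pqmul (partial j F x) (pqi R j)).
  by case: s {FE pE}.
apply: iff_trans (chiral_form_tensor s P0).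
by split=> E i j k; have := E i j k; rewrite !pE.
Qed.

(** The linear chart of the identity matrix: its Jacobian is the identity, so components are
    unchanged. *)
Lemma restrict_chart phi (W : set M) : A phi -> open W -> W `<=` cdom phi ->
  exists chi : chart R M, [/\ A chi, cdom chi = W
    & forall q, W q -> g chi q = g phi q /\ J chi q = J phi q].
Proof.
move=> Aphi oW Wphi.
have QP : (1%:M : 'M[R]_4) *m 1%:M = 1%:M by rewrite mulmx1.
have Achi := linear_chart_atlas oW Wphi QP hM Aphi.
exists (linear_chart oW Wphi QP); split => // q Wq.
have jac := jacobi_linear_chart oW Wphi QP Wq.
split.
  rewrite ((hermitian_metric hgJ).1.2 _ _ q Achi Aphi Wq (Wphi _ Wq)) //.
  by rewrite jac !trmx1 mul1mx mulmx1.
have := (hermitian_tensor hgJ).2 _ _ q Achi Aphi Wq (Wphi _ Wq) I.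
by rewrite jac trmx1 mul1mx mulmx1.
Qed.

Lemma conformal_chart p : conformally_flat A g ->
  exists phi : chart R M, [/\ A phi, cdom phi p
    & forall q, cdom phi q -> exists2 h : R, 0 < h & g phi q = h *: stdG R].
Proof.
move=> /(_ p)[U [h [G [[oU Up] h0 [_ Gflat] gG]]]].
have [phi [Aphi pc phiU [C GC]]] := Gflat p Up.
have [P Pu gP] := hermitian_signature hgJ Aphi pc.
(* [P] normalizes [g] at [p], which is [h p *: C]; the factor [Num.sqrt (h p)] makes it normalize
   the constant matrix [C], hence [G] on the whole chart. *)
pose Q := (Num.sqrt (h p) *: P)^T.
have hp : 0 < Num.sqrt (h p) by rewrite sqrtr_gt0 h0.
have Qu : Q \in unitmx by rewrite unitmx_tr unitmxZ // unitfE gt_eqF.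
have QP : Q *m invmx Q = 1%:M by exact: mulmxV.
have sub : cdom phi `<=` cdom phi by [].
have Achi := linear_chart_atlas (cdom_open phi) sub QP hM Aphi.
exists (linear_chart (cdom_open phi) sub QP); split => // q qc.
exists (h q); first exact/h0/phiU.
rewrite ((hermitian_metric hgJ).1.2 _ _ q Achi Aphi qc qc) //.
rewrite jacobi_linear_chart // (gG _ _ Aphi qc (phiU _ qc)) (GC _ qc) -(GC _ pc).
move: gP; rewrite (gG _ _ Aphi pc Up) => <-.
have -> : Q^T = Num.sqrt (h p) *: P by exact: trmxK.
have hh : h p = Num.sqrt (h p) * Num.sqrt (h p) by rewrite -expr2 sqr_sqrtr // ltW // h0.
rewrite [(_ *: P)^T]linearZ /= -!(scalemxAl, scalemxAr) !scalerA.
by congr (_ *: _); rewrite [in RHS]hh; ring.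
Qed.

Lemma chiral_chart p : conformally_flat A g ->
  exists (s : bool) (phi : chart R M), [/\ A phi, cdom phi p
    & forall q, cdom phi q -> exists2 h : R, 0 < h &
       g phi q = h *: stdG R /\ 0 < chiral_sign R s * chirality (J phi q)].
Proof.
move=> /(conformal_chart p)[phi [Aphi pc gphi]].
pose s := 0 < chirality (J phi p).
pose pf x := chiral_sign R s * chirality (J phi (cinv phi x)).
have cpf x : cimage phi setT x -> {for x, continuous pf}.
  move=> Vx; apply: differentiable_continuous.
  have oV : open (cimage phi setT) by exact: open_cimage openT.
  have dJ i j : differentiable (fun y => J phi (cinv phi y) i j) x.
    exact: smooth_on_differentiable oV ((hermitian_tensor hgJ).1 _ Aphi i j) Vx.
  apply: differentiableM; first exact: differentiable_cst.
  by apply: differentiableB; [apply: differentiableB|]; apply: differentiableM.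
(* The handedness at [p] is kept on an open neighborhood, because the chirality is continuous and
   nonzero at [p]. *)
pose W := [set q | cdom phi q /\ 0 < chiral_sign R s * chirality (J phi q)].
have Wphi : W `<=` cdom phi by move=> q [].
have oW : open W.
  rewrite openE => q [qc q0].
  have cq : {for q, continuous (pf \o cmap phi)}.
    apply: continuous_comp; first exact: cmap_continuous.
    by apply: cpf; exists q.
  have n1 : nbhs q (cdom phi) by apply: open_nbhs_nbhs; split => //; exact: cdom_open.
  have pos : nbhs ((pf \o cmap phi) q) [set r : R | 0 < r].
    by apply: open_nbhs_nbhs; split; [exact: open_gt|rewrite /= /pf cmapK].
  have n2 := cq _ pos.
  apply: filterS2 n1 n2 => r rc r0; apply: (conj rc).
  by move: r0; rewrite /pf /= cmapK.
have [chi [Achi Wchi chiE]] := restrict_chart Aphi oW Wphi.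
exists s, chi; rewrite Wchi; split => //.
- split => //; have [h h0 gh] := gphi _ pc.
  have := chirality_neq0 eps_neq0 h0 gh (hermitian_square hgJ Aphi pc)
    (Omega_skew Aphi pc).
  rewrite neq_lt /s /chiral_sign; case: (ltP 0 (chirality _)) => [pf0 _|_].
    by rewrite mul1r.
  by rewrite orbF mulN1r oppr_gt0.
- move=> q [qc q0]; have [h h0 gh] := gphi _ qc.
  by exists h => //; have [-> ->] := chiE q (conj qc q0).
Qed.

End Manifold.

(** * Conformal scaling, change of chart, and the equivalence *)

Lemma chiralJ_scale (R : realType) (s : bool) (h a b c : R) :
  h *: chiralJ s a b c = chiralJ s (h * a) (h * b) (h * c).
Proof.
apply/matrixP => i j; rewrite [LHS]mxE /chiralJ; move: i j.
by case: s; apply: forall_ord4; apply: forall_ord4;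
  rewrite !mx_of_rowsE //= ?mulr0 ?mulrN.
Qed.

Lemma pqfunE (R : realType) (M : topologicalType) (f1 f2 f3 : M -> R) q :
  [/\ pqfun f1 f2 f3 q ord0 (inord 0) = 0, pqfun f1 f2 f3 q ord0 (inord 1) = f1 q,
      pqfun f1 f2 f3 q ord0 (inord 2) = f2 q & pqfun f1 f2 f3 q ord0 (inord 3) = f3 q].
Proof.
by split; rewrite /pqfun /pqi !mxE -!val_eqE /= !inordK //= ?(mulr0, mulr1, addr0, add0r).
Qed.

Lemma chiral_form_conformal (R : realType) (s : bool) (M : topologicalType)
    (f1 f2 f3 : M -> R) (h : R) q :
  h != 0 ->
  (h *: stdG R) *m chiralJ s (f1 q / h) (f2 q / h) (f3 q / h)
    = chiral_form s (pqfun f1 f2 f3 q).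
Proof.
move=> h0; have [_ E1 E2 E3] := pqfunE f1 f2 f3 q.
by rewrite -scalemxAl scalemxAr chiralJ_scale /chiral_form E1 E2 E3 ![h * _]mulrC !divfK.
Qed.

(** The components of [Omega] in [phi] are the pullback of those in [psi] by the transition map, so
    closedness at one point passes from [psi] to [phi]. *)
Lemma kahler_at (R : realType) (eps : R) (M : topologicalType) (A : set (chart R M))
    (g J : components R M) (phi psi : chart R M) (x : 'rV[R]_4) :
  eps = 1 \/ eps = -1 -> connected_manifold A -> almost_hermitian eps A g J ->
  A phi -> A psi -> cimage phi (cdom psi) x ->
  (forall n l m,
    partial n (Omega_comp g J psi l m) (cmap psi (cinv phi x))
    + partial l (Omega_comp g J psi m n) (cmap psi (cinv phi x))
    + partial m (Omega_comp g J psi n l) (cmap psi (cinv phi x)) = 0) ->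
  forall i j k, partial i (Omega_comp g J phi j k) x
     + partial j (Omega_comp g J phi k i) x
     + partial k (Omega_comp g J phi i j) x = 0.
Proof.
move=> heps hM hgJ Aphi Apsi Ox closed.
have oO : open (cimage phi (cdom psi)) by exact/open_cimage/cdom_open.
have tauE y : \row_l transition phi psi l y = cmap psi (cinv phi y).
  by apply/rowP => l; rewrite mxE.
have imO y : cimage phi (cdom psi) y ->
    [/\ cdom phi (cinv phi y), cdom psi (cinv phi y) & cmap phi (cinv phi y) = y].
  by move=> [q [pq sq] <-]; rewrite cmapK.
have [pq sq _] := imO x Ox.
apply: (@pullback_closed _ _ x (transition phi psi) (Omega_comp g J psi) _ oO) => //.
- exact: (atlas_compatible hM Aphi Apsi).1.
- move=> l m; rewrite tauE; apply: (Omega_comp_differentiable hgJ) => //.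
  by exists (cinv phi x).
- move=> l m; rewrite tauE !Omega_compE cmapK //.
  have /matrixP/(_ l m) := Omega_skew heps hgJ Apsi sq.
  by rewrite mxE [RHS]mxE.
- by move=> n l m; rewrite tauE.
move=> j k y Oy; have [pc sc yE] := imO y Oy.
rewrite tauE Omega_compE (Omega_change hgJ Aphi Apsi pc sc) mxE exchange_big /=.
apply: eq_bigr => m _; rewrite mxE mulr_suml; apply: eq_bigr => l _.
by rewrite Omega_compE cmapK // !mxE yE.
Qed.

Theorem theorem1 (R : realType) (eps : R) (heps : eps = 1 \/ eps = -1)
  (M : topologicalType) (A : set (chart R M)) (hM : connected_manifold A)
  (g J : components R M) (hgJ : almost_hermitian eps A g J)
  (hflat : conformally_flat A g) :
  almost_kahler A g J <->
  (forall p : M, exists (phi : chart R M) (f1 f2 f3 h : M -> R),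
     [/\ A phi /\ cdom phi p,
         (forall q, cdom phi q -> 0 < h q),
         (forall q, cdom phi q ->
            f1 q ^+ 2 - f2 q ^+ 2 - f3 q ^+ 2 = - eps * h q ^+ 2),
         (forall q, cdom phi q -> g phi q = h q *: stdG R)
       & let V := cmap phi @` cdom phi in
         let f := fun x : 'rV[R]_4 => pqfun f1 f2 f3 (cinv phi x) in
         (left_regular V f /\
          forall q, cdom phi q ->
            J phi q = leftJ (f1 q / h q) (f2 q / h q) (f3 q / h q)) \/
         (right_regular V f /\
          forall q, cdom phi q ->
            J phi q = rightJ (f1 q / h q) (f2 q / h q) (f3 q / h q))]).
Proof.
split=> [kah p|regular phi x Aphi [p [pc _] xE] i j k].
  have [s [phi [Aphi pc chi]]] := chiral_chart heps hM hgJ p hflat.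
  (* The conformal factor was only known to exist point by point; since the (0,0) entry of [stdG] is
     -1, this formula gives it as a smooth function. *)
  pose h q := - g phi q (inord 0) (inord 0).
  pose a q := J phi q (inord 0) (inord 1).
  pose b q := J phi q (inord 0) (inord 2).
  pose c q := J phi q (inord 0) (inord 3).
  pose f1 q := h q * a q; pose f2 q := h q * b q; pose f3 q := h q * c q.
  have hE q : cdom phi q -> 0 < h q /\ g phi q = h q *: stdG R.
    move=> /chi[h' h0 [gE _]]; suff -> : h q = h' by [].
    by rewrite /h gE mxE mx_of_rowsE //= mulrN1 opprK.
  have JE q : cdom phi q -> J phi q = chiralJ s (f1 q / h q) (f2 q / h q) (f3 q / h q).
    move=> qc; have [h' h0 [gE pf]] := chi q qc.
    have [hq _] := hE q qc; rewrite /f1 /f2 /f3 ![h q * _]mulrC !mulfK ?gt_eqF //.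
    exact: (chiralJ_of_chirality h0 gE (hermitian_square hgJ Aphi qc)
      (Omega_skew heps hgJ Aphi qc) pf).
  exists phi, f1, f2, f3, h; split => //.
  - by move=> q /hE[].
  - move=> q qc; have [h' h0 [gE pf]] := chi q qc.
    have := chiral_norm h0 gE (hermitian_square hgJ Aphi qc)
      (Omega_skew heps hgJ Aphi qc).
    by rewrite -/(a q) -/(b q) -/(c q) => <-; rewrite /f1 /f2 /f3; ring.
  - by move=> q /hE[].
  move=> V f.
  have reg x : V x -> differentiable f x /\ (if s then DL f x else DR f x) = 0.
    rewrite /V -cimageT => Vx.
    have oV : open (cimage phi setT) by exact: open_cimage openT.
    have dJ l :
        differentiable (fun y => h (cinv phi y) * J phi (cinv phi y) (inord 0) l) x.
      apply: differentiableM.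
        apply: differentiableN.
        exact: smooth_on_differentiable oV ((hermitian_metric hgJ).1.1 _ Aphi _ _) Vx.
      exact: smooth_on_differentiable oV ((hermitian_tensor hgJ).1 _ Aphi _ _) Vx.
    have f0 y : f y ord0 (inord 0) = 0 by have [] := pqfunE f1 f2 f3 (cinv phi y).
    have df : differentiable f x.
      apply: differentiable_rV; apply: forall_ord4.
      - by under eq_fun do rewrite f0; exact: differentiable_cst.
      - have -> : (fun y => f y ord0 (inord 1)) = fun y => f1 (cinv phi y).
          by apply/funext => y; have [] := pqfunE f1 f2 f3 (cinv phi y).
        exact: dJ.
      - have -> : (fun y => f y ord0 (inord 2)) = fun y => f2 (cinv phi y).
          by apply/funext => y; have [] := pqfunE f1 f2 f3 (cinv phi y).
        exact: dJ.
      - have -> : (fun y => f y ord0 (inord 3)) = fun y => f3 (cinv phi y).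
          by apply/funext => y; have [] := pqfunE f1 f2 f3 (cinv phi y).
        exact: dJ.
    split => //; apply/(kahler_chart_regular Vx df f0); last first.
      by move=> i j k; exact: kah.
    move=> y; rewrite cimageT => /cinv_cdom[yc _].
    have [hq gE] := hE _ yc.
    by rewrite gE (JE _ yc) chiral_form_conformal // gt_eqF.
  by case: s {chi} JE reg => JE reg; [left|right]; split.
(* The chart [phi] is arbitrary; closedness is obtained at [p] in the canonical chart [psi] and
   carried back to [phi]. *)
have [psi [f1 [f2 [f3 [h [[Apsi sc] h0 _ gE]]]]]] := regular p.
move=> /= reg.
have pE : cinv phi x = p by rewrite -xE cmapK.
apply: (kahler_at heps hM hgJ Aphi Apsi); first by exists p.
rewrite pE; have Vp : cimage psi setT (cmap psi p) by exists p.
have f0 y : pqfun f1 f2 f3 (cinv psi y) ord0 (inord 0) = 0.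
  by have [] := pqfunE f1 f2 f3 (cinv psi y).
have [s [df Df JE]] : exists s : bool,
   let f := fun y => pqfun f1 f2 f3 (cinv psi y) in
   [/\ differentiable f (cmap psi p),
       (if s then DL f (cmap psi p) else DR f (cmap psi p)) = 0
     & forall q, cdom psi q ->
         J psi q = chiralJ s (f1 q / h q) (f2 q / h q) (f3 q / h q)].
  rewrite -cimageT in reg.
  by case: reg => -[rf JE]; [exists true|exists false]; have [] := rf _ Vp; split.
apply/(kahler_chart_regular Vp df f0); last exact: Df.
move=> y; rewrite cimageT => /cinv_cdom[yc _].
by rewrite gE // JE // chiral_form_conformal // gt_eqF // h0.
Qed.
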